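(* For all integers $k\ge 1$ and $n\ge 1$, $\chi_{la}\big((2k)P_2\vee O_{2n}\big)=3$.
   Context: For a graph $G$ with $q$ edges, a local antimagic labeling is a bijection $f:E(G)\to\{1,\dots,q\}$ such that, writing $f^+(u)=\sum_{e\ni u}f(e)$ (the sum of labels of edges incident to $u$), we have $f^+(u)\ne f^+(v)$ for every edge $uv$. The local antimagic chromatic number $\chi_{la}(G)$ is the minimum, over all local antimagic labelings $f$ of $G$, of the number of distinct values of $f^+$. $P_2$ is the path with one edge, $aP_2$ is the disjoint union of $a$ copies of $P_2$ (a 1-regular graph), $O_m$ is the null (edgeless) graph on $m$ vertices, and $G\vee H$ is the join of $G$ and $H$ (disjoint union plus all edges between $V(G)$ and $V(H)$). *)

(* Defs.v *)
From HB Require Import structures.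
From mathcomp Require Import all_boot.

Set Implicit Arguments.
Unset Strict Implicit.
Unset Printing Implicit Defensive.

Record sgraph := SGraph {
  vertex :> finType;
  adj : rel vertex;
  adj_sym : symmetric adj;
  adj_irrefl : irreflexive adj
}.

Definition edges (G : sgraph) : {set {set G}} :=
  [set e | [exists u, exists v, adj u v && (e == [set u; v])]].

Definition edge (G : sgraph) : finType := {e : {set G} | e \in edges G}.

Definition path_adj (n : nat) : rel 'I_n :=
  [rel i j : 'I_n | (i.+1 == j :> nat) || (j.+1 == i :> nat)].

Lemma path_adj_sym n : symmetric (@path_adj n).
Proof. by move=> i j; rewrite /path_adj /= orbC. Qed.

Lemma path_adj_irrefl n : irreflexive (@path_adj n).
Proof. by move=> i; rewrite /path_adj /= gtn_eqF. Qed.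

Definition path_graph (n : nat) : sgraph :=
  SGraph (@path_adj_sym n) (@path_adj_irrefl n).

Definition null_adj (m : nat) : rel 'I_m := [rel _ _ | false].

Lemma null_adj_sym m : symmetric (@null_adj m).
Proof. by []. Qed.

Lemma null_adj_irrefl m : irreflexive (@null_adj m).
Proof. by []. Qed.

Definition null_graph (m : nat) : sgraph :=
  SGraph (@null_adj_sym m) (@null_adj_irrefl m).

Definition copies_adj (a : nat) (G : sgraph) : rel ('I_a * G)%type :=
  [rel x y : 'I_a * G | (x.1 == y.1) && adj x.2 y.2].

Lemma copies_adj_sym a G : symmetric (@copies_adj a G).
Proof. by move=> x y; rewrite /copies_adj /= eq_sym adj_sym. Qed.

Lemma copies_adj_irrefl a G : irreflexive (@copies_adj a G).
Proof. by move=> x; rewrite /copies_adj /= adj_irrefl andbF. Qed.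

Definition copies (a : nat) (G : sgraph) : sgraph :=
  SGraph (@copies_adj_sym a G) (@copies_adj_irrefl a G).

Definition join_adj (G H : sgraph) : rel (G + H)%type :=
  fun x y => match x, y with
             | inl u, inl v => adj u v
             | inr u, inr v => adj u v
             | _, _ => true
             end.

Lemma join_adj_sym G H : symmetric (@join_adj G H).
Proof. by move=> [u|u] [v|v] //=; rewrite adj_sym. Qed.

Lemma join_adj_irrefl G H : irreflexive (@join_adj G H).
Proof. by move=> [u|u] /=; rewrite adj_irrefl. Qed.

Definition join (G H : sgraph) : sgraph :=
  SGraph (@join_adj_sym G H) (@join_adj_irrefl G H).

(* Labels are shifted: f ranges over {0, ..., q-1}, and the label of the edge e
   is (f e).+1, in {1, ..., q}. *)
Definition labeling (G : sgraph) := edge G -> 'I_#|edges G|.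

Definition vertex_sum (G : sgraph) (f : labeling G) (u : G) : nat :=
  \sum_(e : edge G | u \in val e) (f e).+1.

Definition local_antimagic (G : sgraph) (f : labeling G) : Prop :=
  bijective f /\
  forall u v : G, adj u v -> vertex_sum f u <> vertex_sum f v.

Definition num_colors (G : sgraph) (f : labeling G) : nat :=
  size (undup [seq vertex_sum f u | u : G]).

(* A relation rather than a function, since some graphs (such as P_2) have no
   local antimagic labeling. *)
Definition is_chi_la (G : sgraph) (c : nat) : Prop :=
  (exists2 f : labeling G, local_antimagic f & num_colors f = c) /\
  (forall f : labeling G, local_antimagic f -> c <= num_colors f).

(* Main.v *)
(** The graph contains triangles, so three colours are needed.  Conversely write
    n = m + 1, let q = 8km + 10k be the number of edges, and use 0-based labels.
    The edges of (2k)P_2 receive the middle block 4km+4k, ..., 4km+6k-1.  Two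
    columns (vertices of O_{2n}) together with the middle block use the central
    10k labels: up to a shift, the three labels at an endpoint u_i form a
    2k-column analogue of a Kotzig array on three intervals (one of them with a
    hole, as an exact array requires an odd number of columns), the labels at
    v_i form a Kotzig array on 2k-1 columns plus one extra column that fills this
    hole.  The remaining 2m columns are paired; in each pair of columns a row gets
    two labels l and q-1-l, which leaves the centred row sums unchanged, and low
    and high labels are distributed so that all column sums are equal.  All sums
    at the u_i, at the v_i, and at the vertices of O_{2n} are then constant. *)

Require Import Defs.
From HB Require Import structures.
From mathcomp Require Import all_boot.
From mathcomp Require Import zify.

(** * Explicit edge labels *)

(* b distinguishes the endpoints of an edge of (2k)P_2: [false] for u_i and
   [true] for v_i. *)
Definition big_label (k : nat) (b : bool) (i : nat) : nat :=
  if b then if i == 0 then 6 * k else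
            if i <= k then 8 * k + 1 - 2 * i else 10 * k - 2 * i
  else if i < k then 10 * k - 2 - 2 * i else 12 * k - 1 - 2 * i.

(** For [i < 2 * k] the big and the small label in a row add up to [13 * k - 2 - i] at u_i and to
    [9 * k - 1 - i] at v_i, which cancels the [+ i] of the rung label. The value [3 * k - 1],
    skipped by the u_i, goes to v_0. *)
Definition small_label (k : nat) (b : bool) (i : nat) : nat :=
  if b then if i == 0 then 3 * k - 1 else
            if i <= k then k + i - 2 else i - k - 1
  else if i < k then 3 * k + i else k + i - 1.

(* Interchanging the two labels in row k of the u_i and row 1 of the v_i is what
   makes the two column sums equal. *)
Definition inner_label (k : nat) (b : bool) (i : nat) (c : bool) : nat :=
  if b (+) (i == if b then 1 else k) (+) c then small_label k b i
  else big_label k b i.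

(** For [j >= 2] the columns 2t+2 and 2t+3 share the labels [l] in [4kt, 4k(t+1)) and their
    complements; the parity of [j] and the half of the rows containing [i] decide which of the two
    is used. *)
Definition spoke_label (k m : nat) (b : bool) (i j : nat) : nat :=
  if j < 2 then 4 * k * m + inner_label k b i (j == 1) else
  let l := 4 * k * (j./2 - 1) + (if b then 4 * k - 1 - i else i) in
  if (i < k) (+) odd j then l else 8 * k * m + 10 * k - 1 - l.

Definition rung_label (k m i : nat) : nat := 4 * k * m + 4 * k + i.

(** * Ranges and injectivity of the labels *)

Lemma inner_label_bounds k b i c : i < 2 * k ->
  inner_label k b i c < 4 * k \/ 6 * k <= inner_label k b i c < 10 * k.
Proof.
rewrite /inner_label /big_label /small_label => hi.
by case: ifP => _; case: b; repeat case: ifP => ? ; lia.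
Qed.

(** Small labels lie below 4k, big ones of the v_i in [6k, 8k), big ones of the u_i from 8k on;
    parity separates the two progressions inside each range of big labels. In a given row, being
    small or big determines the column. *)
Lemma inner_label_inj k b b' i i' c c' : i < 2 * k -> i' < 2 * k ->
  inner_label k b i c = inner_label k b' i' c' -> [/\ b = b', i = i' & c = c'].
Proof.
move=> hi hi'; rewrite /inner_label /big_label /small_label.
case: (altP (i =P if b then 1 else k)) => hx;
case: (altP (i' =P if b' then 1 else k)) => hx';
move: hx hx'; case: b; case: b'; case: c; case: c' => /= hx hx';
  repeat case: ifP => ?; move=> e; split; lia.
Qed.

(** Hence complements are at least 4km+10k, and the central 10k labels stay free for the first two
    columns and the rungs. *)
Lemma outer_low k m (b : bool) i j : i < 2 * k -> 1 < j -> j < 2 * m.+1 ->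
  4 * k * (j./2 - 1) + (if b then 4 * k - 1 - i else i) < 4 * k * m.
Proof.
move=> hi hj2 hj; have : j./2 - 1 < m by lia.
move: (j./2 - 1) => t ht; have : k * t.+1 <= k * m by rewrite leq_mul2l ht orbT.
by case: b; lia.
Qed.

Lemma spoke_label_range k m b i j : i < 2 * k -> j < 2 * m.+1 ->
  spoke_label k m b i j < 8 * k * m + 10 * k.
Proof.
move=> hi hj; rewrite /spoke_label; case: (ltnP j 2) => hj2 /=.
  have := inner_label_bounds k b i (j == 1) hi; lia.
have := outer_low k m b i j hi hj2 hj.
by set l := _ + _; case: ifP => _; lia.
Qed.

Lemma mulnD_inj d t t' r r' : r < d -> r' < d ->
  d * t + r = d * t' + r' -> t = t' /\ r = r'.
Proof.
move=> hr hr' e; have d0 : 0 < d by lia.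
split; first by have := congr1 (divn^~ d) e;
  rewrite ![d * _]mulnC !divnMDl // !divn_small // !addn0.
by have := congr1 (modn^~ d) e; rewrite ![d * _]mulnC !modnMDl !modn_small.
Qed.

Lemma spoke_label_inj k m b b' i i' j j' :
    i < 2 * k -> i' < 2 * k -> j < 2 * m.+1 -> j' < 2 * m.+1 ->
  spoke_label k m b i j = spoke_label k m b' i' j' ->
  [/\ b = b', i = i' & j = j'].
Proof.
move=> hi hi' hj hj'; rewrite /spoke_label.
have I c := inner_label_bounds k b i c hi.
have I' c := inner_label_bounds k b' i' c hi'.
case: (ltnP j 2) => h; case: (ltnP j' 2) => h' /=.
- move=> e; have {}e : inner_label k b i (j == 1) = inner_label k b' i' (j' == 1) by lia.
  have [-> -> ?] := inner_label_inj _ _ _ _ _ _ _ hi hi' e; split=> //; lia.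
- have := outer_low _ _ b' _ _ hi' h' hj'; have := I (j == 1).
  by set l := _ + (if b' then _ else _); case: ifP => _; lia.
- have := outer_low _ _ b _ _ hi h hj; have := I' (j' == 1).
  by set l := _ + (if b then _ else _); case: ifP => _; lia.
have := outer_low _ _ b _ _ hi h hj; have := outer_low _ _ b' _ _ hi' h' hj'.
set l := _ + (if b then _ else _); set l' := _ + (if b' then _ else _) => hl' hl e.
(* Low labels and complements have disjoint ranges. *)
have [el ep] : l = l' /\ (i < k) (+) odd j = (i' < k) (+) odd j'.
  by move: e; case: ifP => _; case: ifP => _; split=> //; lia.
(* Division by 4k recovers the pair of columns and the offset; offsets below 2k belong to u_i, the
   others to v_i. *)
have [et er] : j./2 - 1 = j'./2 - 1 /\
    (if b then 4 * k - 1 - i else i) = (if b' then 4 * k - 1 - i' else i').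
  by apply: (@mulnD_inj (4 * k)) => //; [case: (b) | case: (b')]; lia.
have [eb ei] : b = b' /\ i = i' by move: er; case: (b); case: (b'); split; lia.
(* With the row known, low or high determines the parity of [j]. *)
split=> //; move: ep; rewrite ei => /addbI eo.
by rewrite -(odd_double_half j) -(odd_double_half j') eo; lia.
Qed.

Lemma rung_spoke_neq k m b i i' j :
    i < 2 * k -> i' < 2 * k -> j < 2 * m.+1 ->
  rung_label k m i' <> spoke_label k m b i j.
Proof.
move=> hi hi' hj; rewrite /spoke_label /rung_label.
case: (ltnP j 2) => h /=.
  by have := inner_label_bounds k b i (j == 1) hi; lia.
by have := outer_low _ _ b _ _ hi h hj; set l := _ + (if b then _ else _); case: ifP => _; lia.
Qed.

(** * Sums at the endpoints of the edges of (2k)P_2 *)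

Lemma sum_row k m b i : i < 2 * k ->
  rung_label k m i + \sum_(0 <= j < 2 * m.+1) spoke_label k m b i j
  = 12 * k * m + (if b then 13 * k - 1 else 17 * k - 2)
    + m * (8 * k * m + 10 * k - 1).
Proof.
move=> hi.
suff sumE t : t <= m -> \sum_(0 <= j < 2 * t.+1) spoke_label k m b i j =
    spoke_label k m b i 0 + spoke_label k m b i 1 + t * (8 * k * m + 10 * k - 1).
  rewrite sumE // addnA; congr (_ + _).
  rewrite /rung_label /spoke_label /inner_label /= /big_label /small_label.
  by case: b {sumE} => /=; repeat case: ifP => ?; lia.
elim: t => [|t IH] ht; first by rewrite !big_nat_recr //= big_nil; lia.
have -> : 2 * t.+2 = (2 * t.+1).+2 by lia.
rewrite 2?big_nat_recr //= IH; last by lia.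
(* Both columns have the same [l] and opposite parities, so one takes [l] and the other its
   complement. *)
suff : spoke_label k m b i (2 * t.+1) + spoke_label k m b i (2 * t.+1).+1
  = 8 * k * m + 10 * k - 1 by lia.
rewrite /spoke_label.
have -> : (2 * t.+1 < 2) = false by lia.
have -> : ((2 * t.+1).+1 < 2) = false by lia.
have -> : (2 * t.+1).+1./2 = t.+1 by lia.
have -> : (2 * t.+1)./2 = t.+1 by lia.
have := outer_low k m b i (2 * t.+1) hi; have -> : (2 * t.+1)./2 = t.+1 by lia.
move=> /(_ ltac:(lia) ltac:(lia)); set l := _ + _ => hl.
have -> : odd (2 * t.+1) = false by lia.
have -> : odd (2 * t.+1).+1 = true by lia.
by case: (i < k) => /=; lia.
Qed.

(** * Sums at the vertices of O_{2n} *)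

(** This is the sum of an arithmetic progression of difference [s - d], doubled and rearranged to
    avoid division and subtraction. *)
Lemma sum_arith (F : nat -> nat) (a m x d s : nat) :
    (forall i, i < m -> F (a + i) + d * i = x + s * i) ->
  2 * \sum_(a <= i < a + m) F i + d * (m * m) + s * m
  = 2 * (m * x) + s * (m * m) + d * m.
Proof.
elim: m => [|m IH] hF; first by rewrite addn0 big_geq //; lia.
rewrite addnS big_nat_recr /=; last by lia.
have := IH (fun i h => hF i (ltnW h)); have := hF m (ltnSn m).
by move: (\sum_(_ <= i < _) _) (F _) => S Fm; nia.
Qed.

Ltac inner_label_lia :=
  rewrite /inner_label /small_label /big_label /=; do ?case: ifP => ?; lia.

(** Put K = k+1. Without the interchange, columns 0 and 1 would sum to 20K^2-K and 20K^2-3K. It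
    takes 8K from column 0 at u_K and returns 7K at v_1, so both sums become 20K^2-2K. *)
Lemma sum_col_inner k c :
  \sum_(0 <= i < 2 * k.+1) inner_label k.+1 false i c +
    \sum_(0 <= i < 2 * k.+1) inner_label k.+1 true i c
  = 2 * k.+1 * (10 * k + 9).
Proof.
(* The interchanged rows and v_0 are split off; on each remaining range the labels form an
   arithmetic progression. *)
have -> : \sum_(0 <= i < 2 * k.+1) inner_label k.+1 false i c =
  \sum_(0 <= i < 0 + k.+1) inner_label k.+1 false i c +
  (inner_label k.+1 false k.+1 c +
  \sum_(k.+2 <= i < k.+2 + k) inner_label k.+1 false i c).
  rewrite -big_ltn; last by lia.
  have -> : k.+2 + k = 2 * k.+1 by lia.
  by rewrite -big_cat_nat //; lia.
have -> : \sum_(0 <= i < 2 * k.+1) inner_label k.+1 true i c =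
  inner_label k.+1 true 0 c + (inner_label k.+1 true 1 c +
  (\sum_(2 <= i < 2 + k) inner_label k.+1 true i c +
  \sum_(k.+2 <= i < k.+2 + k) inner_label k.+1 true i c)).
  have -> : k.+2 + k = 2 * k.+1 by lia.
  have -> : 2 + k = k.+2 by lia.
  rewrite -big_cat_nat //=; last by lia.
  by rewrite -!big_ltn //; lia.
set A := \sum_(0 <= i < _) _; set B := \sum_(_ <= i < _) inner_label _ false _ _.
set C := \sum_(2 <= i < _) _; set D := \sum_(_ <= i < k.+2 + k) inner_label _ true _ _.
case: c @A @B @C @D => A B C D.
  have -> : inner_label k.+1 false k.+1 true = 10 * k + 9 by inner_label_lia.
  have -> : inner_label k.+1 true 0 true = 6 * k + 6 by inner_label_lia.
  have -> : inner_label k.+1 true 1 true = k by inner_label_lia.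
  have : 2 * A + _ + _ = _ :=
    sum_arith (inner_label k.+1 false ^~ true) 0 k.+1 (3 * k + 3) 0 1
    ltac:(move=> i hi; inner_label_lia).
  have : 2 * B + _ + _ = _ :=
    sum_arith (inner_label k.+1 false ^~ true) k.+2 k (2 * k + 2) 0 1
    ltac:(move=> i hi; inner_label_lia).
  have : 2 * C + _ + _ = _ :=
    sum_arith (inner_label k.+1 true ^~ true) 2 k (8 * k + 5) 2 0
    ltac:(move=> i hi; inner_label_lia).
  have : 2 * D + _ + _ = _ :=
    sum_arith (inner_label k.+1 true ^~ true) k.+2 k (8 * k + 6) 2 0
    ltac:(move=> i hi; inner_label_lia).
  move: A B C D => A B C D; lia.
have -> : inner_label k.+1 false k.+1 false = 2 * k + 1 by inner_label_lia.
have -> : inner_label k.+1 true 0 false = 3 * k + 2 by inner_label_lia.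
have -> : inner_label k.+1 true 1 false = 8 * k + 7 by inner_label_lia.
have : 2 * A + _ + _ = _ :=
    sum_arith (inner_label k.+1 false ^~ false) 0 k.+1 (10 * k + 8) 2 0
    ltac:(move=> i hi; inner_label_lia).
have : 2 * B + _ + _ = _ :=
    sum_arith (inner_label k.+1 false ^~ false) k.+2 k (10 * k + 7) 2 0
    ltac:(move=> i hi; inner_label_lia).
have : 2 * C + _ + _ = _ :=
    sum_arith (inner_label k.+1 true ^~ false) 2 k (k + 1) 0 1
    ltac:(move=> i hi; inner_label_lia).
have : 2 * D + _ + _ = _ :=
    sum_arith (inner_label k.+1 true ^~ false) k.+2 k 0 0 1
    ltac:(move=> i hi; inner_label_lia).
move: A B C D => A B C D; lia.
Qed.

Lemma sum_halves (F : nat -> nat) k :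
  \sum_(0 <= i < 2 * k) F i = \sum_(0 <= i < k) (F i + F (k + i)).
Proof.
rewrite (big_cat_nat (n := k)) //=; last by lia.
rewrite big_split /=; congr (_ + _).
rewrite -{1}[k]add0n big_addn; have -> : 2 * k - k = k by lia.
by apply: eq_bigr => i _; rewrite addnC.
Qed.

Lemma sum_col k m j : 0 < k -> j < 2 * m.+1 ->
  \sum_(0 <= i < 2 * k) (spoke_label k m false i j + spoke_label k m true i j)
  = 2 * k * (8 * k * m + 10 * k - 1).
Proof.
case: k => // k _ hj; case: (ltnP j 2) => h.
  rewrite (eq_bigr (fun i => 2 * (4 * k.+1 * m) +
    (inner_label k.+1 false i (j == 1) + inner_label k.+1 true i (j == 1)))).
    rewrite big_split /= sum_nat_const_nat big_split /= sum_col_inner subn0.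
    have -> : 8 * k.+1 * m + 10 * k.+1 - 1 = 8 * k.+1 * m + (10 * k + 9) by lia.
    by lia.
  by move=> i _; rewrite /spoke_label h; lia.
(* In every row the values [l] of u_i and v_i have the same sum. Of two rows at distance [k.+1], one
   takes these values and the other complements, so the four labels add up to 2(q-1). *)
rewrite sum_halves.
rewrite (eq_big_nat _ _ (F2 := fun=> 2 * (8 * k.+1 * m + 10 * k.+1 - 1))).
  by rewrite sum_nat_const_nat subn0; lia.
move=> i /andP[_ hi].
have lowE b i' := outer_low k.+1 m b i' j.
rewrite /spoke_label ltnNge h /= hi.
have -> : (k.+1 + i < k.+1) = false by lia.
have := lowE false i ltac:(lia) h hj; have := lowE true i ltac:(lia) h hj.
have := lowE false (k.+1 + i) ltac:(lia) h hj.
have := lowE true (k.+1 + i) ltac:(lia) h hj => {lowE}.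
have -> : 8 * k.+1 * m = 2 * (4 * k.+1 * m) by lia.
move: (4 * k.+1 * (j./2 - 1)) (4 * k.+1 * m) => x y.
by case: (odd j) => /=; lia.
Qed.

(** * Labelings from an enumeration of the edges, and the lower bound *)

(** The labeling is [l] composed with the inverse of [phi]; being injective between finite sets of
    equal size, it is bijective. *)
Lemma labeling_of (G : sgraph) (I : finType) (phi : I -> {set G}) (l : I -> nat) :
    injective phi -> edges G = [set phi x | x : I] ->
    injective l -> (forall x, l x < #|I|) ->
  exists2 f : labeling G, bijective f &
    forall u, vertex_sum f u = \sum_(x | u \in phi x) (l x).+1.
Proof.
move=> phi_inj phiE l_inj l_lt.
have phiP x : phi x \in edges G by rewrite phiE imset_f.
pose psi x : edge G := Sub (phi x) (phiP x).
have cardE : #|edges G| = #|I| by rewrite phiE card_imset.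
have [g gK Kg] : bijective psi.
  apply: inj_card_bij; last by rewrite card_sig -cardE.
  by move=> x y /(congr1 val); apply: phi_inj.
have f_lt e : l (g e) < #|edges G| by rewrite cardE.
exists (fun e => Ordinal (f_lt e)).
  apply: inj_card_bij; last by rewrite card_ord card_sig.
  by move=> e e' [] /l_inj /(can_inj Kg).
move=> u; rewrite /vertex_sum (reindex psi) /=; last by exists g => x _.
by apply: eq_bigr => x _; rewrite gK.
Qed.

Lemma vertex_sum_triangle (G : sgraph) (f : labeling G) (u v w : G) :
  adj u v -> adj v w -> adj u w -> local_antimagic f -> 3 <= num_colors f.
Proof.
move=> uv vw uw [_ f_neq].
have sub : {subset [:: vertex_sum f u; vertex_sum f v; vertex_sum f w]
    <= undup [seq vertex_sum f x | x : G]}.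
  by move=> c; rewrite !inE mem_undup => /or3P[] /eqP->; apply: image_f.
apply: (uniq_leq_size _ sub) => /=; rewrite !inE negb_or.
by do 3 ?[apply/andP; split]; apply/eqP; do ?apply: f_neq.
Qed.

(** * Edges of the join *)

(** On the left the rungs; on the right the spokes as (copy, endpoint, null vertex), with [ord0] for
    u_i and [ord_max] for v_i. *)
Definition edge_index (a b : nat) : finType := ('I_a + 'I_a * 'I_2 * 'I_b)%type.

Definition edge_set (a b : nat) (x : edge_index a b) :
    {set join (copies a (path_graph 2)) (null_graph b)} :=
  match x with
  | inl i => [set inl (i, ord0); inl (i, ord_max)]
  | inr (i, c, j) => [set inl (i, c); inr j]
  end.

Lemma edge_set_inj a b : injective (edge_set a b).
Proof.
have I2 (c : 'I_2) : c = ord0 \/ c = ord_max.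
  by case: c => [[|[|c]] hc]; [left | right | ]; try exact: val_inj; lia.
move=> [i|[[i c] j]] [i'|[[i' c'] j']] /setP e.
- by have := e (inl (i, ord0)); rewrite !inE eqxx /= => /esym /orP[] /eqP[->].
- by have := e (inr j'); rewrite !inE eqxx orbT.
- by have := e (inr j); rewrite !inE eqxx orbT.
have := e (inr j); rewrite !inE eqxx orbT /= => /esym /eqP [<-].
by have := e (inl (i, c)); rewrite !inE eqxx /= orbF => /esym /eqP [<- <-].
Qed.

Lemma edges_join a b :
  edges (join (copies a (path_graph 2)) (null_graph b)) =
  [set edge_set a b x | x : edge_index a b].
Proof.
apply/setP => e; apply/idP/imsetP => [|[[i|[[i c] j]] _ ->]]; last first.
- by rewrite inE; apply/existsP; exists (inl (i, c)); apply/existsP; exists (inr j);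
    rewrite eqxx.
- rewrite inE; apply/existsP; exists (inl (i, ord0)); apply/existsP.
  by exists (inl (i, ord_max)); rewrite /= eqxx !andbT /copies_adj /= eqxx.
rewrite inE => /existsP[u /existsP[v /andP[uv /eqP->]]].
case: u v uv => [[i c]|j] [[i' c']|j'] //=.
- rewrite /copies_adj /= => /andP[/eqP -> cc']; exists (inl i') => //=.
  case: c c' cc' => [[|[|c]] hc] [[|[|c']] hc'] //= _; last rewrite setUC;
    by congr [set inl (_, _); inl (_, _)]; apply: val_inj.
- by move=> _; exists (inr (i, c, j')).
by move=> _; exists (inr (i', c', j)) => //=; rewrite setUC.
Qed.

(** * Vertex sums of the labeling *)

Definition edge_label (k m : nat) (x : edge_index (2 * k) (2 * m.+1)) : nat :=
  match x with
  | inl i => rung_label k m i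
  | inr (i, c, j) => spoke_label k m (c == ord_max) i j
  end.

Lemma card_edge_index k m :
  #|edge_index (2 * k) (2 * m.+1)| = 8 * k * m + 10 * k.
Proof. by rewrite card_sum !card_prod !card_ord; lia. Qed.

Lemma edge_label_lt k m x : edge_label k m x < 8 * k * m + 10 * k.
Proof.
case: x => [[i hi]|[[[i hi] c] [j hj]]] /=; first by rewrite /rung_label; lia.
exact: spoke_label_range.
Qed.

Lemma edge_label_inj k m : injective (edge_label k m).
Proof.
move=> [i|[[i c] j]] [i'|[[i' c'] j']] /=.
- by move/addnI/val_inj->.
- by move/rung_spoke_neq => H; case: H.
- by move/esym/rung_spoke_neq => H; case: H.
case/spoke_label_inj => // ec /val_inj -> /val_inj ->.
congr (inr (_, _, _)); apply: val_inj.
by case: c c' ec => [[|[|c]] hc] [[|[|c']] hc'].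
Qed.

Lemma sum_edge_index_inl a b (l : edge_index a b -> nat) (i : 'I_a) (c : 'I_2) :
  \sum_(x | inl (i, c) \in edge_set a b x) l x =
  l (inl i) + \sum_(j < b) l (inr (i, c, j)).
Proof.
rewrite big_sumType /=; congr (_ + _).
  rewrite (big_pred1 i) // => i'; rewrite !inE.
  have [->|neq] := eqVneq i' i; last first.
    by apply/negbTE/negP => /orP[] /eqP[ei]; rewrite ei eqxx in neq.
  case: c => [[|[|c]] hc] //; apply/orP; [left | right]; apply/eqP;
    by congr (inl (_, _)); apply: val_inj.
transitivity (\sum_(p | (p.1 == (i, c)) && true) l (inr (p.1, p.2))).
  apply: eq_big => [|[q j] _] //= [[i' c'] j] /=.
  by rewrite !inE orbF andbT eq_sym.
rewrite -(pair_big (pred1 (i, c)) xpredT (fun q j => l (inr (q, j)))) /=.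
by rewrite big_pred1_eq.
Qed.

Lemma sum_edge_index_inr a b (l : edge_index a b -> nat) (j : 'I_b) :
  \sum_(x | inr j \in edge_set a b x) l x =
  \sum_(i < a) (l (inr (i, ord0, j)) + l (inr (i, ord_max, j))).
Proof.
rewrite big_sumType /= big_pred0 ?add0n => [|i]; last by rewrite !inE.
transitivity (\sum_(p | true && (p.2 == j)) l (inr (p.1, p.2))).
  apply: eq_big => [|[q j'] _] //= [[i c] j'] /=.
  by rewrite !inE /= eq_sym.
rewrite -(pair_big xpredT (pred1 j) (fun q j => l (inr (q, j)))) /=.
rewrite (eq_bigr (fun q => l (inr (q, j)))) => [|q _]; last by rewrite big_pred1_eq.
rewrite (eq_bigr (fun q => l (inr (q.1, q.2, j)))) => [|[] //].
rewrite -(pair_bigA _ (fun i c => l (inr (i, c, j)))) /=.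
apply: eq_bigr => i _; rewrite !big_ord_recl big_ord0 addn0; congr (_ + l (inr (_, _, _))).
exact: val_inj.
Qed.

(** The summand [(2 * m).+3] is the degree of the vertex: each incident edge adds 1 to its 0-based
    label. *)
Lemma sum_edge_label_inl k m (i : 'I_(2 * k)) (c : 'I_2) :
  \sum_(x | inl (i, c) \in edge_set (2 * k) (2 * m.+1) x) (edge_label k m x).+1 =
  (2 * m).+3 + (12 * k * m + (if c == ord_max then 13 * k - 1 else 17 * k - 2)
    + m * (8 * k * m + 10 * k - 1)).
Proof.
rewrite sum_edge_index_inl -(sum_row _ _ (c == ord_max) _ (ltn_ord i)) big_mkord /=.
rewrite (eq_bigr (fun j : 'I_(2 * m.+1) => spoke_label k m (c == ord_max) i j + 1)).
  by rewrite big_split sum_nat_const card_ord /=; lia.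
by move=> j _; rewrite addn1.
Qed.

Lemma sum_edge_label_inr k m (j : 'I_(2 * m.+1)) : 0 < k ->
  \sum_(x | inr j \in edge_set (2 * k) (2 * m.+1) x) (edge_label k m x).+1 =
  4 * k + 2 * k * (8 * k * m + 10 * k - 1).
Proof.
move=> hk; rewrite sum_edge_index_inr -(sum_col _ _ _ hk (ltn_ord j)) big_mkord /=.
rewrite (eq_bigr (fun i : 'I_(2 * k) =>
    spoke_label k m false i j + spoke_label k m true i j + 2)).
  by rewrite big_split sum_nat_const card_ord /=; lia.
by move=> i _; rewrite addn2 addSn addnS.
Qed.

(** * Three colours are necessary and suffice *)

Theorem theorem2p1 (k n : nat) (hk : 1 <= k) (hn : 1 <= n) :
  is_chi_la (join (copies (2 * k) (path_graph 2)) (null_graph (2 * n))) 3.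
Proof.
case: n hn => // m _.
set G := join _ _.
have ge3 (f : labeling G) : local_antimagic f -> 3 <= num_colors f.
  have h2k : 0 < 2 * k by lia.
  have h2m : 0 < 2 * m.+1 by lia.
  (* The triangle consists of one copy of P_2 and a vertex of O_{2n}. *)
  by apply: (@vertex_sum_triangle G f (inl (Ordinal h2k, ord0))
    (inl (Ordinal h2k, ord_max)) (inr (Ordinal h2m))).
split=> //.
have [f f_bij fE] := @labeling_of G _ _ (edge_label k m)
  (edge_set_inj (2 * k) (2 * m.+1)) (edges_join _ _) (edge_label_inj k m)
  (fun x => ltac:(rewrite card_edge_index; exact: edge_label_lt)).
pose A b := (2 * m).+3 + (12 * k * m + (if b then 13 * k - 1 else 17 * k - 2)
    + m * (8 * k * m + 10 * k - 1)).
pose C := 4 * k + 2 * k * (8 * k * m + 10 * k - 1).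
have fl i c : vertex_sum f (inl (i, c)) = A (c == ord_max).
  by rewrite fE sum_edge_label_inl.
have fr j : vertex_sum f (inr j) = C by rewrite fE sum_edge_label_inr.
(* The two values differ by [4 * k - 1]. *)
have A_neq : A false <> A true by rewrite /A; lia.
have A_C b : A b <> C.
  (* 2 * A b = (2m+3)(q+1) +- (4k-1) and 2 * C = 4k(q+1), where 2m+3 is odd. *)
  rewrite /A /C; set q := 8 * k * m + 10 * k.
  have q1 : q - 1 + 1 = q by rewrite /q; lia.
  have [p2|p2] := leqP (2 * m + 4) (4 * k).
    have : (2 * m + 4) * (q - 1) <= 4 * k * (q - 1) by rewrite leq_mul2r p2 orbT.
    by move: (q - 1) q1 => r; rewrite /q; case: b; lia.
  have {}p2 : 4 * k <= 2 * m + 2 by lia.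
  have : 4 * k * (q - 1) <= (2 * m + 2) * (q - 1) by rewrite leq_mul2r p2 orbT.
  by move: (q - 1) q1 => r; rewrite /q; case: b; lia.
have f_la : local_antimagic f.
  split=> // -[[i c]|j] [[i' c']|j'] //=; rewrite ?fl ?fr.
  - case/andP=> _; case: c c' => [[|[|c]] hc] [[|[|c']] hc'] //= _;
      first [exact: A_neq | move/esym; exact: A_neq].
  - by move=> _; apply: A_C.
  by move=> _ /esym; apply: A_C.
exists f => //; apply/eqP; rewrite eqn_leq ge3 // andbT.
rewrite /num_colors; apply: (@uniq_leq_size _ _ [:: A false; A true; C]).
  exact: undup_uniq.
move=> c; rewrite mem_undup => /imageP[[[i c']|j] _ ->]; rewrite ?fl ?fr !inE.
  by case: (_ == ord_max); rewrite eqxx ?orbT.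
by rewrite eqxx !orbT.
Qed.
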